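(* Let $\mathcal{K}$ be the class of all nonempty compact metric spaces. For each $n\in\mathbb{N}$, the assignment $\mathcal{K}\ni K\mapsto C_n(K)\in K^{(1)}$ is a distinguishing; that is, whenever $K,L\in\mathcal{K}$ and $\Phi$ is an isometry of $K$ onto $L$, then $\Phi^{(1)}(C_n(K))=C_n(L)$.
   Context: For a metric space $X$ let $X^{(1)}$ be the set of orbits of points of $X$ under the group of all isometries of $X$ onto $X$, and let $\pi_X^{(1)}\colon X\to X^{(1)}$ be the canonical projection. For an isometry $\Phi$ of $Y$ onto $Z$, $\Phi^{(1)}\colon Y^{(1)}\to Z^{(1)}$ is the unique function with $\pi_Z^{(1)}\circ\Phi=\Phi^{(1)}\circ\pi_Y^{(1)}$. Here $\mathbb{N}=\{0,1,2,\ldots\}$. For an infinite compact metric space $(X,d)$ a metric $\varrho_X$ on $\mathbb{N}$ is constructed recursively. On $\{0\}$ it is the trivial metric. If $\varrho_X$ has been defined on $\{0,\ldots,n\}$ so that $(\{0,\ldots,n\},\varrho_X)$ embeds isometrically into $X$, put $$F_n:=\{(x_0,\ldots,x_n)\in X^{n+1}: d(x_j,x_k)=\varrho_X(j,k),\ j,k=0,\ldots,n\},$$ $$f_n\colon F_n\times X\to\mathbb{R},\quad f_n(x_0,\ldots,x_n;x):=\min(d(x_0,x),\ldots,d(x_n,x)),$$ $$A_0^{n+1}:=\{(x;y)\in F_n\times X: f_n(x;y)=\max f_n(F_n\times X)\},$$ and for $j=1,\ldots,n+1$ $$A_j^{n+1}:=\bigl\{(y_0,\ldots,y_n;y)\in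 A_{j-1}^{n+1}: d(y_{j-1},y)=\max\{d(x_{j-1},x): (x_0,\ldots,x_n;x)\in A_{j-1}^{n+1}\}\bigr\}.$$ Take any $(x_0,\ldots,x_n;x_{n+1})\in A_{n+1}^{n+1}$ (a nonempty set) and put $\varrho_X(j,n+1)=\varrho_X(n+1,j):=d(x_j,x_{n+1})$ for $j=0,\ldots,n+1$; this is independent of the choice. If $X$ is finite with $N$ elements, the same procedure, stopped after $N$ points, gives a metric $\varrho_X$ on $\{0,\ldots,N-1\}$ making this set isometric to $X$. A representation of $\varrho_X$ is: for infinite $X$, any isometric (distance-preserving) function $\Phi\colon(\mathbb{N},\varrho_X)\to(X,d)$; for $X$ finite with $N$ elements, any function $\Phi\colon\mathbb{N}\to X$ that is isometric on $(\{0,\ldots,N-1\},\varrho_X)$ and satisfies $\Phi(k)=\Phi(N-1)$ for $k>N-1$. Representations exist, and the function $\pi_X^{(1)}\circ\Phi$ is the same for every representation $\Phi$ of $\varrho_X$. Define $C_n(X):=\pi_X^{(1)}(\Phi(n))$ for $n\in\mathbb{N}$, where $\Phi$ is any representation of $\varrho_X$. *)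

(* Defs.v *)
From HB Require Import structures.
From mathcomp Require Import all_boot all_order all_algebra.
From mathcomp Require Import boolp classical_sets functions cardinality.
From mathcomp Require Import reals topology.
From mathcomp Require Export metric_structure.
Set Implicit Arguments.
Unset Strict Implicit.
Unset Printing Implicit Defensive.
Import Order.TTheory GRing.Theory Num.Theory.
Local Open Scope classical_set_scope.
Local Open Scope ring_scope.

Section isometries.
Context {R : realType}.

Definition isometry_onto (X Y : metricType R) (f : X -> Y) : Prop :=
  (forall x y, mdist (f x) (f y) = mdist x y) /\ set_surj [set: X] [set: Y] f.

Definition isom_orbit (X : metricType R) (x : X) : set X :=
  [set g x | g in @isometry_onto X X].

(* X^(1) *)
Definition orbit_space (X : metricType R) : Type :=
  {O : set X | range (@isom_orbit X) O}.

(* pi_X^(1) *)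
Definition orbit_proj (X : metricType R) (x : X) : orbit_space X :=
  exist _ (isom_orbit x) (ex_intro2 _ _ x I erefl).

Definition orbit_repr (X : metricType R) (o : orbit_space X) : X :=
  sval (cid2 (proj2_sig o)).

(* Phi^(1); [orbit_mapE] and [orbit_map_unique] show that it is the unique
   function with pi_Z^(1) \o Phi = Phi^(1) \o pi_Y^(1) when Phi is an isometry
   of Y onto Z. *)
Definition orbit_map (Y Z : metricType R) (Phi : Y -> Z)
    (o : orbit_space Y) : orbit_space Z :=
  orbit_proj (Phi (orbit_repr o)).

Lemma isometry_onto_id (X : metricType R) : isometry_onto (@id X).
Proof. by split => // y _; exists y. Qed.

Lemma isometry_onto_comp (X Y Z : metricType R) (g : Y -> Z) (f : X -> Y) :
  isometry_onto g -> isometry_onto f -> isometry_onto (g \o f).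
Proof.
move=> [dg sg] [df sf]; split => [x y /=|z _]; first by rewrite dg df.
by have [y _ <-] := sg z I; have [x _ <-] := sf y I; exists x.
Qed.

Lemma isometry_onto_inv (X Y : metricType R) (f : X -> Y) :
  isometry_onto f ->
  exists g : Y -> X, [/\ isometry_onto g, cancel f g & cancel g f].
Proof.
move=> [df sf]; pose g y := sval (cid2 (sf y I)).
have gK : cancel g f by move=> y; rewrite /g; case: cid2.
have fK : cancel f g.
  by move=> x; apply: mdist_positivity; rewrite -df gK mdistxx.
exists g; split => //; split => [x y|x _]; first by rewrite -df !gK.
by exists (f x).
Qed.

Lemma orbit_reprK (X : metricType R) : cancel (@orbit_repr X) (@orbit_proj X).
Proof.
move=> [O hO]; apply: eq_exist; rewrite /orbit_repr /=.
by case: cid2.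
Qed.

Lemma orbit_projP (X : metricType R) (x y : X) :
  orbit_proj x = orbit_proj y <->
  exists2 g : X -> X, isometry_onto g & g x = y.
Proof.
split=> [/(congr1 sval)/= xy|[g ig <-]].
  suff : isom_orbit x y by case=> g ig gx; exists g.
  by rewrite xy; exists id => //; exact: isometry_onto_id.
apply: eq_exist; apply/seteqP; split => z [h ih <-].
  have [k [ik gk _]] := isometry_onto_inv ig.
  by exists (h \o k); [exact: isometry_onto_comp|rewrite /= gk].
by exists (h \o g) => //; exact: isometry_onto_comp.
Qed.

Lemma orbit_mapE (Y Z : metricType R) (Phi : Y -> Z) : isometry_onto Phi ->
  @orbit_proj Z \o Phi = orbit_map Phi \o @orbit_proj Y.
Proof.
move=> iPhi; apply/funext => y /=; apply/orbit_projP.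
have [Psi [iPsi PhiK _]] := isometry_onto_inv iPhi.
have [g ig gy] := (orbit_projP _ _).1 (esym (orbit_reprK (orbit_proj y))).
exists (Phi \o g \o Psi); last by rewrite /= PhiK gy.
by do 2!apply: isometry_onto_comp => //.
Qed.

Lemma orbit_map_unique (Y Z : metricType R) (Phi : Y -> Z)
    (h : orbit_space Y -> orbit_space Z) : isometry_onto Phi ->
  @orbit_proj Z \o Phi = h \o @orbit_proj Y -> h = orbit_map Phi.
Proof.
move=> iPhi hE; apply/funext => o; rewrite -(orbit_reprK o).
by rewrite -[LHS](congr1 (@^~ _) hE) [LHS](congr1 (@^~ _) (orbit_mapE iPhi)).
Qed.

End isometries.

Section canonical_metric.
Context {R : realType} (X : metricType R).

(* {p in S | g p = max g(S)} *)
Definition maximizers T (S : set T) (g : T -> R) : set T :=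
  [set p | S p /\ ubound (g @` S) (g p)].

(* F_n; only the values of rho on {0, ..., n} matter. *)
Definition config (n : nat) (rho : nat -> nat -> R) : set ('I_n.+1 -> X) :=
  [set x | forall j k : 'I_n.+1, mdist (x j) (x k) = rho j k].

(* f_n; the index 0 supplies the neutral value of the iterated minimum. *)
Definition dist_to_config (n : nat) (p : ('I_n.+1 -> X) * X) : R :=
  \big[Num.min/mdist (p.1 ord0) p.2]_(j < n.+1) mdist (p.1 j) p.2.

(* A_j^{n+1}, for 0 <= j <= n + 1 *)
Fixpoint greedy_set (n : nat) (rho : nat -> nat -> R) (j : nat) :
    set (('I_n.+1 -> X) * X) :=
  if j is i.+1 then
    maximizers (@greedy_set n rho i) (fun p => mdist (p.1 (inord i)) p.2)
  else maximizers (@config n rho `*` [set: X]) (@dist_to_config n).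

(* The distances d(x_j, x_{n+1}), j = 0, ..., n, for a chosen
   (x_0, ..., x_n; x_{n+1}) in A_{n+1}^{n+1}. *)
Definition greedy_dist (n : nat) (rho : nat -> nat -> R) : 'I_n.+1 -> R :=
  xget (fun=> 0)
    [set (fun j => mdist (p.1 j) p.2) | p in @greedy_set n rho n.+1].

(* rho_X on {0, ..., n}, with junk value 0 elsewhere. *)
Fixpoint canonical_dist_upto (n : nat) : nat -> nat -> R :=
  if n is m.+1 then
    let rho := canonical_dist_upto m in
    fun j k =>
      if (j <= m)%N && (k <= m)%N then rho j k
      else if (j <= m)%N && (k == m.+1) then @greedy_dist m rho (inord j)
      else if (j == m.+1) && (k <= m)%N then @greedy_dist m rho (inord k)
      else 0
  else fun _ _ => 0.

(* rho_X. When X has N elements only the values on {0, ..., N - 1} are used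
   below; they do not depend on the later steps of the recursion. *)
Definition canonical_dist (j k : nat) : R := canonical_dist_upto (maxn j k) j k.

Definition representation (Phi : nat -> X) : Prop :=
  (infinite_set [set: X] /\
    forall j k, mdist (Phi j) (Phi k) = canonical_dist j k) \/
  (exists N : nat, [/\ ([set: X] #= `I_N)%card,
    forall j k, (j < N)%N -> (k < N)%N ->
      mdist (Phi j) (Phi k) = canonical_dist j k &
    forall k, (N.-1 < k)%N -> Phi k = Phi N.-1]).

End canonical_metric.

Record compactMetric (R : realType) := CompactMetric {
  compactMetric_space :> metricType R ;
  compactMetric_neq0 : [set: compactMetric_space] !=set0 ;
  compactMetric_compact : compact [set: compactMetric_space] }.

(* C_n(K). Representations exist for every K, so the default value of [xget]
   is never used; the orbit does not depend on the representation chosen. *)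
Definition canonical_orbit (R : realType) (n : nat) (K : compactMetric R) :
    orbit_space K :=
  orbit_proj
    (xget (fun=> sval (cid (compactMetric_neq0 K))) (@representation R K) n).

(* Main.v *)
(* All suprema in the construction of rho_X are attained by compactness, so
   every finite stage embeds into X and, by Tychonoff, so does all of
   (nat, rho_X): representations exist. A representation missing a ball of
   radius e would be e-separated by the greedy choice, so its range is dense;
   hence two representations of the same metric differ by an isometry of X
   onto X, the extension of u n |-> v n to closures. Finally rho_X only depends
   on the isometry class of X, so an isometry Phi of K onto L turns
   representations of rho_K into representations of rho_L. *)
Require Import Defs.
From mathcomp Require Import all_boot all_order all_algebra.
From mathcomp Require Import boolp classical_sets reals topology.
From mathcomp Require Import cardinality normedtype derive.
From mathcomp Require Import lra.
Set Implicit Arguments.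
Unset Strict Implicit.
Unset Printing Implicit Defensive.
Import Order.TTheory GRing.Theory Num.Theory.
Import numFieldNormedType.Exports.
Local Open Scope classical_set_scope.
Local Open Scope ring_scope.

(** * Distances and dense sequences in compact metric spaces *)

Section metric_facts.
Context {R : realType} (X : metricType R).
Implicit Types x y : X.

Lemma mdist_diff x y x' y' :
  `|mdist x y - mdist x' y'| <= mdist x x' + mdist y y'.
Proof.
have h1 := metric_triangle x x' y; have h2 := metric_triangle x' y' y.
have h3 := metric_triangle x' x y'; have h4 := metric_triangle x y y'.
have := metric_sym x x'; have := metric_sym y y'.
by rewrite ler_norml; lra.
Qed.

Lemma cvg_mdist T (F : set_system T) {FF : Filter F} (f g : T -> X) x y :
  f @ F --> x -> g @ F --> y -> mdist (f t) (g t) @[t --> F] --> mdist x y.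
Proof.
move=> /metricType_numDomainType.cvgrPdist_lt fx.
move=> /metricType_numDomainType.cvgrPdist_lt gy.
apply/cvgrPdist_le => e e0; have e20 : 0 < e / 2 by rewrite divr_gt0.
near=> t; apply: le_trans (mdist_diff _ _ _ _) _; rewrite [leRHS]splitr.
by apply: lerD; apply: ltW; near: t; [exact: fx|exact: gy].
Unshelve. all: by end_near. Qed.

(** The sequence would have a cluster point [y], with two distinct terms within [e / 2] of it. *)
Lemma compact_no_separated_seq (u : nat -> X) (e : R) :
  compact [set: X] -> 0 < e ->
  ~ (forall j k, (j < k)%N -> e <= mdist (u j) (u k)).
Proof.
move=> cX e0 sep.
have [y [_ cy]] := cX (u @ \oo) _ filterT.
have e20 : 0 < e / 2 by rewrite divr_gt0.
have near_y m : exists2 k, (m <= k)%N & mdist y (u k) < e / 2.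
  have [|_ [[k mk <-] yk]] :=
    cy [set u k | k in [set k | (m <= k)%N]] _ _ (nbhsx_ballx y _ e20).
    by exists m => // k mk; exists k.
  by exists k => //; move: yk; rewrite ballEmdist.
have [j _ yj] := near_y 0%N; have [k jk yk] := near_y j.+1.
have := sep _ _ jk; have := metric_triangle (u j) y (u k).
by rewrite (metric_sym (u j) y); lra.
Qed.

(* The graph of the extension is the closure of {(u j, v j)} in X * X. *)
Lemma equidistant_dense_seq_isometry (u v : nat -> X) : compact [set: X] ->
  (forall j k, mdist (u j) (u k) = mdist (v j) (v k)) ->
  (forall x e, 0 < e -> exists j, mdist (u j) x < e) ->
  (forall x e, 0 < e -> exists j, mdist (v j) x < e) ->
  exists2 g : X -> X, isometry_onto g & forall n, g (u n) = v n.
Proof.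
move=> cX uv.
pose G (a b : nat -> X) x y := forall e, 0 < e ->
  exists2 j, mdist (a j) x < e & mdist (b j) y < e.
have total a b : (forall x e, 0 < e -> exists j, mdist (a j) x < e) ->
    forall x, exists y, G a b x y.
  move=> da x.
  (* [F] is generated by the terms of [b] whose counterparts in [a] are close to [x]; any cluster
     point of it is a partner of [x]. *)
  pose F := filter_from [set e : R | 0 < e]
    (fun e => [set b j | j in [set j | mdist (a j) x < e]]).
  have FF : ProperFilter F.
    apply: filter_from_proper; last first.
      by move=> e /(da x)[j ajx]; exists (b j); exists j.
    apply: filter_from_filter; first by exists 1 => /=.
    move=> e1 e2 /= e10 e20; exists (Num.min e1 e2).
      by rewrite /= lt_min e10.
    move=> _ [j jx <-]; move: jx; rewrite /= lt_min => /andP[? ?].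
    by split; exists j.
  have [y [_ cy]] := cX F _ filterT.
  exists y => e e0.
  have [|_ [[j jx <-] yj]] :=
    cy [set b j | j in [set j | mdist (a j) x < e]] _ _ (nbhsx_ballx y _ e0).
    by exists e.
  by exists j => //; move: yj; rewrite ballEmdist /= metric_sym.
have isoG x y x' y' : G u v x y -> G u v x' y' -> mdist y y' = mdist x x'.
  move=> Gxy Gxy'; apply/eqP; rewrite -subr_eq0 -normr_le0.
  apply/ler_addgt0Pl => e e0; rewrite addr0.
  (* Four approximations, one for each of [x], [x'], [y], [y'], share the error [e]. *)
  have e40 : 0 < e / 4 by rewrite divr_gt0.
  have [j xj yj] := Gxy _ e40; have [k xk yk] := Gxy' _ e40.
  have := mdist_diff y y' (v j) (v k); have := mdist_diff (u j) (u k) x x'.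
  rewrite uv (metric_sym y (v j)) (metric_sym y' (v k)).
  by rewrite !ler_norml; lra.
move=> du dv; have /choice[g Gg] := total u v du.
exists g; last first.
  move=> n; apply: mdist_positivity; rewrite (isoG (u n) _ (u n)) ?mdistxx //.
  by move=> e e0; exists n; rewrite mdistxx.
split=> [x y|y _]; first exact: isoG.
(* Surjectivity: the same construction with [u] and [v] exchanged yields a preimage. *)
have [x Gyx] := total v u dv y; exists x => //.
apply: mdist_positivity; rewrite (isoG x _ x) ?mdistxx //.
by move=> e /Gyx[j ? ?]; exists j.
Qed.

End metric_facts.

Lemma continuous_bigmin (R : realType) (T : topologicalType) I (s : seq I)
    (f0 : T -> R) (f : I -> T -> R) :
  continuous f0 -> (forall i, continuous (f i)) ->
  continuous (fun t => \big[Num.min/f0 t]_(i <- s) f i t).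
Proof.
move=> cf0 cf; elim: s => [|i s IHs].
  by rewrite (_ : (fun _ => _) = f0) //; apply/funext => t; rewrite big_nil.
rewrite (_ : (fun _ => _) =
    f i \min fun t => \big[Num.min/f0 t]_(i <- s) f i t).
  by move=> t; apply: continuous_min; [exact: cf|exact: IHs].
by apply/funext => t; rewrite big_cons.
Qed.

(** * Sets of maximizers *)

Section maximizers.
Context {R : realType}.

(** The maximum is attained at some [c], so the maximizers are the part of [S] in the closed
    superlevel set of [g] at [g c]. *)
Lemma maximizers_compact (T : topologicalType) (S : set T) (g : T -> R) :
  continuous g -> compact S -> S !=set0 ->
  compact (maximizers S g) /\ maximizers S g !=set0.
Proof.
move=> cg cS S0.
have [c /set_mem Sc cmax] := compact_EVT_max S0 cS (continuous_subspaceT cg).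
have -> : maximizers S g = S `&` g @^-1` [set r | g c <= r].
  apply/seteqP; split=> p [Sp pmax]; split => //.
    by apply: pmax; exists c.
  move=> _ [q Sq <-]; apply: le_trans pmax.
  by apply: cmax; exact/mem_set.
split; last by exists c; split => /=.
apply: compact_closedI => //; exact: preimage_closed.
Qed.

(** Since [h] is surjective, every competitor in [S'] comes from one in [S]. *)
Lemma maximizers_transport T U (h : T -> U) (S : set T) (S' : set U)
    (g : T -> R) (g' : U -> R) :
  (forall q, exists p, h p = q) -> (forall p, S' (h p) <-> S p) ->
  (forall p, g' (h p) = g p) ->
  forall p, maximizers S' g' (h p) <-> maximizers S g p.
Proof.
move=> sh hS hg p; split=> -[/hS Sp pmax]; split => // _ [q Sq <-].
  by rewrite -!hg; apply: pmax; exists (h q) => //; exact/hS.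
have [r rq] := sh q; rewrite -rq !hg; apply: pmax; exists r => //.
by apply/hS; rewrite rq.
Qed.

End maximizers.

(** * The greedy construction and its representations *)

Section canonical.
Context {R : realType} (X : metricType R).

Lemma dist_to_config_le n (p : ('I_n.+1 -> X) * X) j :
  dist_to_config p <= mdist (p.1 j) p.2.
Proof. exact: bigmin_le. Qed.

Lemma dist_to_config_ge n (p : ('I_n.+1 -> X) * X) e :
  (forall j, e <= mdist (p.1 j) p.2) -> e <= dist_to_config p.
Proof. by move=> pe; apply/bigmin_geP; split. Qed.

Lemma greedy_set0 n (rho : nat -> nat -> R) j :
  @greedy_set R X n rho j `<=` @greedy_set R X n rho 0.
Proof. by elim: j => // j IHj p [/IHj]. Qed.

(** Each recursion step adds one row and one column and keeps the earlier values. *)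
Lemma canonical_dist_uptoE n j k : (j <= n)%N -> (k <= n)%N ->
  canonical_dist_upto X n j k = canonical_dist X j k.
Proof.
rewrite /canonical_dist => jn kn.
have : (maxn j k <= n)%N by rewrite geq_max jn.
elim: n {jn kn} => [|n IHn]; first by rewrite leqn0 => /eqP ->.
rewrite leq_eqVlt => /predU1P[->//|]; rewrite ltnS => /[dup] le_n.
by rewrite geq_max /= => ->; exact: IHn.
Qed.

Lemma canonical_distS j n : (j <= n)%N ->
  canonical_dist X j n.+1 =
  @greedy_dist R X n (canonical_dist_upto X n) (inord j).
Proof.
move=> jn; rewrite /canonical_dist (maxn_idPr (leqW jn)) /= jn ltnn /=.
by rewrite eqxx.
Qed.

Lemma canonical_dist_sym j k : canonical_dist X j k = canonical_dist X k j.
Proof.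
rewrite /canonical_dist maxnC; elim: (maxn k j) => [//|n IHn] /=.
by case: (leqP j n); case: (leqP k n) => //= kn jn; rewrite ?andbT ?andbF.
Qed.

Lemma canonical_distxx j : canonical_dist X j j = 0.
Proof.
rewrite /canonical_dist maxnn; elim: j => //= n _; rewrite ltnn /=.
by rewrite andbF.
Qed.

Lemma configP n (x : 'I_n.+1 -> X) :
  config (canonical_dist_upto X n) x <->
  forall j k, mdist (x j) (x k) = canonical_dist X j k.
Proof.
by split=> h j k; move: (h j k); rewrite canonical_dist_uptoE ?leq_ord.
Qed.

Hypothesis cX : compact [set: X].

(** Gives the functions in [config] the product topology, for Tychonoff. *)
Let power n := (prod_topology (fun _ : 'I_n.+1 => X)).

Let coord_mdist_continuous n (j : 'I_n.+1) :
  continuous (fun p : power n * X => mdist (p.1 j) p.2 : R).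
Proof.
move=> p; apply: cvg_mdist; last exact: cvg_snd.
apply: (@cvg_comp _ _ _ fst (fun x : power n => x j)); first exact: cvg_fst.
exact: proj_continuous.
Qed.

Let dist_to_config_continuous n :
  continuous (fun p : power n * X => dist_to_config p : R).
Proof.
apply: (@continuous_bigmin _ (power n * X)%type _ _
  (fun p => mdist (p.1 ord0) p.2) (fun j p => mdist (p.1 j) p.2)).
- exact: coord_mdist_continuous.
- by move=> j; exact: coord_mdist_continuous.
Qed.

Let config_compact n (rho : nat -> nat -> R) :
  compact (@config R X n rho : set (power n)).
Proof.
have cT : compact [set: power n].
  have := @tychonoff _ (fun _ : 'I_n.+1 => X) (fun=> setT) (fun=> cX).
  by congr compact; apply/seteqP; split.
apply: (subclosed_compact _ cT) => //.
have -> : config rho = \bigcap_(jk in [set: 'I_n.+1 * 'I_n.+1])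
    (fun x : power n => mdist (x jk.1) (x jk.2)) @^-1` [set rho jk.1 jk.2].
  apply/seteqP; split=> [x xrho [j k] _|x xrho j k]; first exact: xrho.
  exact: (xrho (j, k)).
apply: closed_bigI => -[j k] _; apply: preimage_closed; last exact: closed_eq.
move=> x _; apply: (@cvg_mdist _ _ _ (nbhs x) _ (@^~ j) (@^~ k)).
- exact: (@proj_continuous _ (fun=> X) j).
- exact: (@proj_continuous _ (fun=> X) k).
Qed.

(** Each stage maximizes a continuous function over the compact nonempty set left by the previous
    one. *)
Lemma greedy_set_compact n (rho : nat -> nat -> R) j :
  @config R X n rho !=set0 ->
  compact (@greedy_set R X n rho j : set (power n * X)) /\
  @greedy_set R X n rho j !=set0.
Proof.
move=> [x xrho].
elim: j => [|j [IHc IH0]] /=; apply: maximizers_compact => //.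
- exact: dist_to_config_continuous.
- by apply: compact_setX; first exact: config_compact.
- by exists (x, x ord0).
- exact: coord_mdist_continuous.
Qed.

Lemma greedy_distP n (rho : nat -> nat -> R) : @config R X n rho !=set0 ->
  exists2 p, @greedy_set R X n rho n.+1 p &
    forall j, greedy_dist X rho j = mdist (p.1 j) p.2.
Proof.
move=> /(greedy_set_compact n.+1)[_ [p gp]].
have [|q gq qE] := @xgetPex _ (fun=> 0)
    [set (fun j => mdist (p.1 j) p.2) | p in @greedy_set R X n rho n.+1].
  by exists (fun j => mdist (p.1 j) p.2); exists p.
by exists q => // j; rewrite /greedy_dist -qE.
Qed.

(** Appending the greedy point [y] to its own configuration [x] realizes the next stage; [x] need
    not extend earlier configurations. *)
Lemma config_canonical_neq0 n : [set: X] !=set0 ->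
  @config R X n (canonical_dist_upto X n) !=set0.
Proof.
move=> [x0 _]; elim: n => [|n IHn].
  by exists (fun=> x0) => j k; rewrite mdistxx.
have [[x y] gxy dxy] := greedy_distP IHn.
have [[/configP xX _] _] := greedy_set0 gxy.
exists (fun j : 'I_n.+2 => if (j <= n)%N then x (inord j) else y).
apply/configP => j k.
have last_ord (i : 'I_n.+2) : (n < i)%N -> i = n.+1 :> nat.
  by move=> ni; apply/eqP; rewrite eqn_leq ni -ltnS ltn_ord.
have [jn|/last_ord jn] := leqP j n; have [kn|/last_ord kn] := leqP k n.
- by rewrite xX !inordK.
- by rewrite kn canonical_distS// dxy.
- by rewrite jn canonical_dist_sym canonical_distS// dxy metric_sym.
- by rewrite jn kn canonical_distxx mdistxx.
Qed.

(** As the finite embeddings need not be nested, a cluster point of them in the compact space of all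
    sequences is taken. *)
Lemma canonical_dist_realized : [set: X] !=set0 ->
  exists u : nat -> X, forall j k, mdist (u j) (u k) = canonical_dist X j k.
Proof.
move=> X0.
pose P := (prod_topology (fun _ : nat => X)).
have /choice[u uX] n : exists u : P, forall j k, (j <= n)%N -> (k <= n)%N ->
    mdist (u j) (u k) = canonical_dist X j k.
  have [x /configP xX] := config_canonical_neq0 n X0.
  by exists (fun j => x (inord j)) => j k jn kn; rewrite xX !inordK.
have cT : compact [set: P].
  have := @tychonoff _ (fun _ : nat => X) (fun=> setT) (fun=> cX).
  by congr compact; apply/seteqP; split.
have [v [_]] := cT (u @ \oo) _ filterT.
rewrite cluster_cvgE => -[G PG [Gv uG]].
exists v => j k; apply/esym.
have cG : mdist (w j) (w k) @[w --> G] --> mdist (v j) (v k).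
  apply: (@cvg_mdist _ _ _ G _ (@^~ j) (@^~ k)).
  - exact: cvg_trans (cvg_app _ Gv) (@proj_continuous _ (fun=> X) j v).
  - exact: cvg_trans (cvg_app _ Gv) (@proj_continuous _ (fun=> X) k v).
apply: (cvg_unique _ _ cG) => //; apply: cvg_near_cst.
(* From [n = maxn j k] on, [u n] has the prescribed distance at [j], [k], so it is constant along
   the finer filter [G]. *)
apply: uG; exists (maxn j k) => // n /=; rewrite geq_max => /andP[jn kn].
exact: uX.
Qed.

Lemma representation_exists : [set: X] !=set0 ->
  exists u : nat -> X, representation u.
Proof.
move=> X0; have [u uX] := canonical_dist_realized X0.
have [[N XN]|Xinf] := pselect (finite_set [set: X]); last by exists u; left.
(* Freezing the sequence at index [N.-1] gives the form required for finite spaces. *)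
exists (fun k => u (minn k N.-1)); right; exists N; split => //.
- have trunc i : (i < N)%N -> minn i N.-1 = i.
    by move=> iN; apply/minn_idPl; rewrite -ltnS (ltn_predK iN).
  by move=> j k jN kN; rewrite !trunc.
- by move=> k Nk; rewrite minnn (minn_idPr (ltnW Nk)).
Qed.

(* A point at distance at least e from u 0, ..., u m forces the greedy choice
   of u m.+1 to be at distance at least e from them as well. *)
Lemma canonical_separated (u : nat -> X) N x e :
  (forall j k, (j < N)%N -> (k < N)%N ->
    mdist (u j) (u k) = canonical_dist X j k) ->
  (forall j, (j < N)%N -> e <= mdist (u j) x) ->
  forall j k, (j < k)%N -> (k < N)%N -> e <= mdist (u j) (u k).
Proof.
move=> uX ux j [//|m] jm mN; rewrite uX ?canonical_distS ?(ltn_trans jm)//.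
have uC : config (canonical_dist_upto X m) (fun i : 'I_m.+1 => u i).
  by apply/configP => i k; rewrite uX // (ltn_trans _ mN).
have [|p gp ->] := @greedy_distP m (canonical_dist_upto X m).
  by eexists; exact: uC.
(* The configuration in [p] may differ from [u], but [p] is maximal over all configurations, hence
   beats [u 0, ..., u m] paired with [x]. *)
apply: le_trans (dist_to_config_le _ _).
have [_ pmax] := greedy_set0 gp.
apply: le_trans (pmax _ (imageP _ (conj uC I : (config _ `*` setT) (_, x)))).
by apply: dist_to_config_ge => i; rewrite ux // (ltn_trans _ mN).
Qed.

Lemma representation_dense (u : nat -> X) : representation u ->
  forall x e, 0 < e -> exists j, mdist (u j) x < e.
Proof.
move=> ru x e e0; apply: contrapT => /forallNP nu.
have {}nu j : e <= mdist (u j) x by rewrite leNgt; exact/negP.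
case: ru => [[_ uX]|[N [XN uX _]]].
  apply: (compact_no_separated_seq cX e0 (u := u)) => j k jk.
  by apply: (@canonical_separated u k.+1 x).
have sep j k : (j < k)%N -> (k < N)%N -> e <= mdist (u j) (u k).
  by apply: (@canonical_separated u N x).
(* Adding [x] to the [N] separated terms gives [N.+1] distinct points in a space of [N] elements. *)
pose v k := if (k < N)%N then u k else x.
have vsep j k : (j < k)%N -> (k < N.+1)%N -> e <= mdist (v j) (v k).
  rewrite /v => jk kN; rewrite (leq_trans jk) //.
  by case: ifP => // ?; exact: sep.
have vinj : {in `I_N.+1 &, injective v}.
  move=> j k /set_mem/= jN /set_mem/= kN vjk; apply/eqP.
  case: ltngtP => // [jk|kj]; exfalso.
    by move: (vsep _ _ jk kN); rewrite vjk mdistxx leNgt e0.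
  by move: (vsep _ _ kj jN); rewrite vjk mdistxx leNgt e0.
have : (v @` `I_N.+1 #<= [set: X])%card by exact: subset_card_le.
by rewrite (card_le_eql (inj_card_eq vinj)) (card_le_eqr XN) card_le_II ltnn.
Qed.

Lemma representation_orbit (u v : nat -> X) n :
  representation u -> representation v -> orbit_proj (u n) = orbit_proj (v n).
Proof.
move=> ru rv; apply/orbit_projP.
suff uv j k : mdist (u j) (u k) = mdist (v j) (v k).
  have [g ig guv] := equidistant_dense_seq_isometry cX uv
    (representation_dense ru) (representation_dense rv).
  by exists g.
case: ru rv => [[Xinf uX]|[N [XN uX uN]]] [[Yinf vX]|[M [XM vX vM]]].
- by rewrite uX vX.
- by case: Xinf; exists M.
- by case: Yinf; exists N.
have NM : N = M by apply/card_eq_II; rewrite -(card_eql XN).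
subst M.
have N0 : (0 < N)%N.
  case: N XN {uX uN XM vX vM} => //; rewrite II0 card_eq0 => /eqP X0.
  by have : [set: X] (u 0) by []; rewrite X0.
(* Indices past [N.-1] fold back to [N.-1], where the values of [canonical_dist] apply. *)
have trunc (w : nat -> X) i : (forall k, (N.-1 < k)%N -> w k = w N.-1) ->
    w i = w (minn i N.-1).
  by move=> wN; case: leqP => // /wN.
have ltN i : (minn i N.-1 < N)%N by rewrite -(prednK N0) ltnS geq_minr.
rewrite (trunc u j)// (trunc u k)// (trunc v j)// (trunc v k)//.
by rewrite uX ?vX.
Qed.

End canonical.

(** * Invariance under isometries *)

Section isometry_invariance.
Context {R : realType} (K L : metricType R) (Phi : K -> L).
Hypothesis iPhi : isometry_onto Phi.

Let lift n (p : ('I_n.+1 -> K) * K) : ('I_n.+1 -> L) * L :=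
  (Phi \o p.1, Phi p.2).

Let lift_surj n (q : ('I_n.+1 -> L) * L) : exists p, lift p = q.
Proof.
have [Psi [_ _ PsiK]] := isometry_onto_inv iPhi.
exists (Psi \o q.1, Psi q.2); case: q => x y; rewrite /lift /= PsiK.
by congr pair; apply/funext => i /=; rewrite PsiK.
Qed.

Let lift_greedy_set n rho j (p : ('I_n.+1 -> K) * K) :
  greedy_set rho j (lift p) <-> greedy_set rho j p.
Proof.
elim: j p => [|j IHj]; apply: maximizers_transport => //=.
- by move=> p; split=> -[h _]; split=> // i k; have := h i k; rewrite /= iPhi.1.
- move=> p; rewrite /dist_to_config /= iPhi.1.
  by under eq_bigr do rewrite iPhi.1.
- by move=> p; rewrite iPhi.1.
Qed.

(** At each step [xget] chooses from the same set of distance functions for [K] and for [L], so the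
    choices coincide. *)
Lemma canonical_dist_isometry : canonical_dist K = canonical_dist L.
Proof.
suff E n : canonical_dist_upto K n = canonical_dist_upto L n.
  by apply/funext => j; apply/funext => k; rewrite /canonical_dist E.
elim: n => //= n ->; apply/funext => j; apply/funext => k.
suff -> : @greedy_dist R K n = @greedy_dist R L n by [].
apply/funext => rho; rewrite /greedy_dist; congr xget.
apply/seteqP; split=> [_ [p gp <-]|_ [q + <-]].
  exists (lift p); first exact/lift_greedy_set.
  by apply/funext => i /=; rewrite iPhi.1.
have [p <-] := lift_surj q => /lift_greedy_set gp; exists p => //.
by apply/funext => i /=; rewrite iPhi.1.
Qed.

(** [Phi] is a bijection, so the finite and infinite cases correspond with the same [N]. *)
Lemma representation_isometry (u : nat -> K) :
  representation u -> representation (Phi \o u).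
Proof.
have LK : ([set: L] #= [set: K])%card.
  have -> : [set: L] = Phi @` setT.
    by apply/seteqP; split => // y _; have [x _ <-] := iPhi.2 y I; exists x.
  apply: inj_card_eq => x y _ _ xy; apply: mdist_positivity.
  by rewrite -iPhi.1 xy mdistxx.
rewrite /representation -canonical_dist_isometry.
case=> [[Kinf uK]|[N [KN uK uN]]]; [left|right].
  split=> [|j k]; last by rewrite /= iPhi.1.
  by rewrite (eq_finite_set LK).
exists N; split=> [|j k jN kN|k Nk /=]; last by rewrite uN.
  by rewrite (card_eql LK).
by rewrite /= iPhi.1 uK.
Qed.

End isometry_invariance.

Lemma canonical_orbitP (R : realType) (K : compactMetric R) n :
  exists2 u : nat -> K,
    representation u & canonical_orbit n K = orbit_proj (u n).
Proof.
have ex := representation_exists (@compactMetric_compact _ K)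
  (compactMetric_neq0 K).
by eexists; last reflexivity; exact: xgetPex.
Qed.

Theorem proposition6p3 (R : realType) (n : nat) (K L : compactMetric R)
    (Phi : K -> L) (isoPhi : isometry_onto Phi) :
  orbit_map Phi (canonical_orbit n K) = canonical_orbit n L.
Proof.
have [u ru ->] := canonical_orbitP K n; have [v rv ->] := canonical_orbitP L n.
rewrite -[LHS](congr1 (@^~ (u n)) (orbit_mapE isoPhi)) /=.
(* [Phi \o u] and [v] both represent the canonical metric of [L]. *)
exact: (representation_orbit (@compactMetric_compact _ L) n
  (representation_isometry isoPhi ru) rv).
Qed.
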